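(* Let $C^\bullet$ be a cosimplicial chain complex with finitely generated torsion-free components. Then $$\overline{\mathrm{Tot}}(\iota):\overline{\mathrm{Tot}}(C^\bullet)\to\overline{\mathrm{Tot}}(F_{\mathcal S}(C^\bullet))\quad\text{and}\quad |m|:\overline{\mathrm{Tot}}(F_{\mathcal S}(C^\bullet))\to\overline{\mathrm{Tot}}(C^\bullet)$$ are natural mutually inverse homotopy equivalences. Moreover, $|m|\circ\overline{\mathrm{Tot}}(\iota)=\mathrm{id}$ and there is a natural cochain homotopy between $\overline{\mathrm{Tot}}(\iota)\circ|m|$ and $\mathrm{id}$.
   Context: Chain complexes are $\mathbb{Z}$-graded complexes of abelian groups. A cosimplicial chain complex $C^\bullet=C^\bullet_*$ is a cosimplicial object in chain complexes: chain complexes $(C^q_*,\partial)$, $q\ge0$, with chain maps $d_i:C^q_*\to C^{q+1}_*$ ($0\le i\le q+1$) and $s_i:C^q_*\to C^{q-1}_*$ ($0\le i\le q-1$) satisfying the cosimplicial identities. Its components are the abelian groups $C^q_k$. **$F_{\mathcal S}$.** $F_{\mathcal S}(C^\bullet)$ is the cosimplicial chain complex with $F_{\mathcal S}(C^\bullet)^q=\bigoplus_{\sigma\in S_q}C^q$ ($S_q$ the symmetric group, $S_0$ trivial); $(a,\sigma)$ denotes $a\in C^q$ in the summand indexed by $\sigma$, and $\partial(a,\sigma)=(\partial a,\sigma)$. Its structure maps are $d_i(a,\sigma)=(d_{\bar\sigma(i)}(a),d_i(\sigma))$ for $0\le i\le q+1$ and $s_i(a,\sigma)=(s_{\sigma(i+1)-1}(a),s_i(\sigma))$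 for $0\le i\le q-1$. Here $\bar\sigma$ fixes $0$ and $q+1$ and equals $\sigma$ on $\{1,\ldots,q\}$; $d_0(\sigma)=1\times\sigma$, $d_{q+1}(\sigma)=\sigma\times1$, and for $1\le i\le q$, $d_i(\sigma)\in S_{q+1}$ is obtained by doubling the $i$-th input of $\sigma$ (the input $i$ is replaced by two adjacent inputs sent, in the same order, to two adjacent outputs replacing $\sigma(i)$); $s_i(\sigma)\in S_{q-1}$ is obtained by deleting the input $i+1$ and its image. (This is the cosimplicial object underlying the free object over the crossed interval group $\mathcal S$ of symmetric groups.) The map $\iota:C^\bullet\to F_{\mathcal S}(C^\bullet)$, $\iota(a)=(a,1)$, is cosimplicial. **Totalization.** For a cosimplicial chain complex $C^\bullet_*$ let $\mathcal N(C^\bullet_* )$ denote the groups $C^m_k$ with vertical differential $\partial$ and horizontal differential $d:C^m_k\to C^{m+1}_k$, $d(c)=\sum_{0\le i\le m+1}(-1)^{i+k}d_i(c)$, so that $\partial d+d\partial=0$. For such data $E^*_*$ (groups $E^m_k$, $m\ge0$, $k\in\mathbb{Z}$, with anticommuting differentials $d:E^m_k\to E^{m+1}_k$, $\partial:E^m_{k+1}\to E^m_k$), $|E^*_*|^*$ is the cochain complex with $|E^*_*|^m=\prod_{n-k=m}E^n_k$ and differential $d(a^0,a^1,a^2,\ldots)=(-\partial a^0,\,da^0-\partial a^1,\,da^1-\partial a^2,\ldots)$. Put $\overline{\mathrm{Tot}}(C^\bullet)=|\mathcal N(C^\bullet)|$. **The map $m$.** $m:\mathcal N(F_{\mathcal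 S}(C^\bullet))\to\mathcal N(C^\bullet)$ is $m(a,\sigma)=\mathrm{sgn}(\sigma)\,a$; it commutes with both differentials and is natural in $C^\bullet$; $|m|$ is the induced map of the complexes $|-|$. *)

(* Defs.v *)
From HB Require Import structures.
From mathcomp Require Import all_boot all_order all_algebra all_fingroup.
From mathcomp Require Import boolp zify ring.
Set Implicit Arguments.
Unset Strict Implicit.
Unset Printing Implicit Defensive.
Import Order.TTheory GRing.Theory Num.Theory.
Local Open Scope ring_scope.

Definition finitely_generated (A : zmodType) : Prop :=
  exists n (s : n.-tuple A), forall x, inIntSpan s x.

Definition torsion_free (A : zmodType) : Prop :=
  forall (x : A) (n : nat), (0 < n)%N -> x *+ n = 0 -> x = 0.

Record chainComplex := ChainComplex {
  ch_ob :> int -> zmodType;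
  ch_d : forall k, {additive ch_ob (k + 1) -> ch_ob k};
  ch_dd : forall k x, ch_d k (ch_d (k + 1) x) = 0 }.

Record chainMap (C D : chainComplex) := ChainMap {
  cm_fun :> forall k, {additive C k -> D k};
  cm_comm : forall k x, ch_d D k (cm_fun (k + 1) x) = cm_fun k (ch_d C k x) }.

(* Coface and codegeneracy indices live in ordinals; in the cosimplicial
   identities the indices are natural numbers, and [inord] only turns them into
   ordinals of the type that is required at each place: with the stated bounds
   it is never applied out of range. *)
Record cosimplicial := Cosimplicial {
  cs_ob :> nat -> chainComplex;
  cs_d : forall q, 'I_q.+2 -> chainMap (cs_ob q) (cs_ob q.+1);
  cs_s : forall q, 'I_q.+1 -> chainMap (cs_ob q.+1) (cs_ob q);
  cs_dd : forall q k (x : cs_ob q k) (i j : nat), (i < j <= q.+2)%N ->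
    cs_d (inord j) k (cs_d (inord i) k x) =
    cs_d (inord i) k (cs_d (inord j.-1) k x);
  cs_ss : forall q k (x : cs_ob q.+2 k) (i j : nat), (i <= j <= q)%N ->
    cs_s (inord j) k (cs_s (inord i) k x) =
    cs_s (inord i) k (cs_s (inord j.+1) k x);
  cs_sd_lt : forall q k (x : cs_ob q.+1 k) (i j : nat), (i < j <= q.+1)%N ->
    cs_s (inord j) k (cs_d (inord i) k x) =
    cs_d (inord i) k (cs_s (inord j.-1) k x);
  cs_sd_id : forall q k (x : cs_ob q k) (i j : nat), (j <= q)%N ->
    (i == j) || (i == j.+1) ->
    cs_s (inord j) k (cs_d (inord i) k x) = x;
  cs_sd_gt : forall q k (x : cs_ob q.+1 k) (i j : nat), (j.+1 < i <= q.+2)%N ->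
    cs_s (inord j) k (cs_d (inord i) k x) =
    cs_d (inord i.-1) k (cs_s (inord j) k x) }.

Record cosimplicialMap (C D : cosimplicial) := CosimplicialMap {
  csm_fun :> forall q, chainMap (C q) (D q);
  csm_d : forall q (i : 'I_q.+2) k x,
    csm_fun q.+1 k (cs_d C i k x) = cs_d D i k (csm_fun q k x);
  csm_s : forall q (i : 'I_q.+1) k x,
    csm_fun q k (cs_s C i k x) = cs_s D i k (csm_fun q.+1 k x) }.

Definition fg_torsion_free_components (C : cosimplicial) : Prop :=
  forall q k, finitely_generated (C q k) /\ torsion_free (C q k).

Record cochainComplex := CochainComplex {
  co_ob :> int -> zmodType;
  co_d : forall m, {additive co_ob m -> co_ob (m + 1)};
  co_dd : forall m x, co_d (m + 1) (co_d m x) = 0 }.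

Record cochainMap (X Y : cochainComplex) := CochainMap {
  com_fun :> forall m, {additive X m -> Y m};
  com_comm : forall m x, co_d Y m (com_fun m x) = com_fun (m + 1) (co_d X m x) }.

Program Definition cochain_id (X : cochainComplex) : cochainMap X X :=
  @CochainMap X X (fun m => GRing.Additive.clone _ _ idfun _) _.

Program Definition cochain_comp (X Y Z : cochainComplex)
    (g : cochainMap Y Z) (f : cochainMap X Y) : cochainMap X Z :=
  @CochainMap X Z (fun m => GRing.Additive.clone _ _ (g m \o f m) _) _.
Next Obligation. by rewrite !com_comm. Qed.

(* Every integer is of the form [m + 1], so the homotopy identity below is
   required in all degrees. *)
Definition cochain_homotopy (X Y : cochainComplex) (f g : cochainMap X Y)
    (h : forall m, {additive X (m + 1)%R -> Y m}) : Prop :=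
  forall m (x : X (m + 1)%R),
    f (m + 1) x - g (m + 1) x =
    co_d Y m (h m x) + h (m + 1) (co_d X (m + 1) x).

Definition homotopic (X Y : cochainComplex) (f g : cochainMap X Y) : Prop :=
  exists h, @cochain_homotopy X Y f g h.

Definition mutually_inverse_homotopy_equivalences (X Y : cochainComplex)
    (f : cochainMap X Y) (g : cochainMap Y X) : Prop :=
  homotopic (cochain_comp g f) (cochain_id X) /\
  homotopic (cochain_comp f g) (cochain_id Y).

Record bicomplex := Bicomplex {
  bi_ob :> nat -> int -> zmodType;
  bi_h : forall n k, {additive bi_ob n k -> bi_ob n.+1 k};
  bi_v : forall n k, {additive bi_ob n (k + 1) -> bi_ob n k};
  bi_hh : forall n k x, bi_h n.+1 k (bi_h n k x) = 0;
  bi_vv : forall n k x, bi_v n k (bi_v n (k + 1) x) = 0;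
  bi_hv : forall n k x, bi_v n.+1 k (bi_h n (k + 1) x) + bi_h n k (bi_v n k x) = 0 }.

Record bicomplexMap (E E' : bicomplex) := BicomplexMap {
  bm_fun :> forall n k, {additive E n k -> E' n k};
  bm_h : forall n k x, bi_h E' n k (bm_fun n k x) = bm_fun n.+1 k (bi_h E n k x);
  bm_v : forall n k x, bi_v E' n k (bm_fun n (k + 1) x) = bm_fun n k (bi_v E n k x) }.

(* The product of the [E n k] over all pairs with [n - k = m]. *)
Definition tot_ob (E : bicomplex) (m : int) : Type :=
  forall (n : nat) (k : int), n%:Z - k == m -> E n k.

HB.instance Definition _ E m := gen_eqMixin (tot_ob E m).
HB.instance Definition _ E m := gen_choiceMixin (tot_ob E m).

Section TotZmodule.
Variables (E : bicomplex) (m : int).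
Implicit Types a b c : tot_ob E m.

Lemma tot_ext a b : (forall n k e, a n k e = b n k e) -> a = b.
Proof.
move=> ab; apply: functional_extensionality_dep => n.
by do 2![apply: functional_extensionality_dep => ?]; apply: ab.
Qed.

Definition tot_zero : tot_ob E m := fun n k e => 0.
Definition tot_opp a : tot_ob E m := fun n k e => - a n k e.
Definition tot_add a b : tot_ob E m := fun n k e => a n k e + b n k e.

Lemma tot_addA : associative tot_add.
Proof. by move=> a b c; apply: tot_ext => *; apply: addrA. Qed.
Lemma tot_addC : commutative tot_add.
Proof. by move=> a b; apply: tot_ext => *; apply: addrC. Qed.
Lemma tot_add0 : left_id tot_zero tot_add.
Proof. by move=> a; apply: tot_ext => *; apply: add0r. Qed.
Lemma tot_addN : left_inverse tot_zero tot_opp tot_add.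
Proof. by move=> a; apply: tot_ext => *; apply: addNr. Qed.

HB.instance Definition _ :=
  GRing.isZmodule.Build (tot_ob E m) tot_addA tot_addC tot_add0 tot_addN.
End TotZmodule.

Lemma tot_index_v (n : nat) (k m : int) : n%:Z - k == m + 1 -> n%:Z - (k + 1) == m.
Proof. lia. Qed.

Lemma tot_index_h (n : nat) (k m : int) : n.+1%:Z - k == m + 1 -> n%:Z - k == m.
Proof. lia. Qed.

Definition tot_d (E : bicomplex) (m : int) (a : tot_ob E m) : tot_ob E (m + 1) :=
  fun n => match n with
  | 0 => fun k e => - bi_v E 0 k (a 0 (k + 1) (tot_index_v e))
  | n'.+1 => fun k e => bi_h E n' k (a n' k (tot_index_h e))
                        - bi_v E n'.+1 k (a n'.+1 (k + 1) (tot_index_v e))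
  end.

Lemma tot_d_additive E m : zmod_morphism (@tot_d E m).
Proof.
move=> a b; apply: tot_ext => -[|n] k e /=.
  have -> p : (a - b) 0 (k + 1) p = a 0 (k + 1) p - b 0 (k + 1) p by [].
  have -> (x y : tot_ob E (m + 1)) : (x - y) 0 k e = x 0 k e - y 0 k e by [].
  by rewrite /= (raddfB (bi_v E 0 k)) opprB opprK addrC.
have -> p : (a - b) n k p = a n k p - b n k p by [].
have -> p : (a - b) n.+1 (k + 1) p = a n.+1 (k + 1) p - b n.+1 (k + 1) p by [].
have -> (x y : tot_ob E (m + 1)) : (x - y) n.+1 k e = x n.+1 k e - y n.+1 k e by [].
rewrite /= (raddfB (bi_h E n k)) (raddfB (bi_v E n.+1 k)) !opprB.
by rewrite (addrC (bi_v _ _ _ _)) addrACA (addrC (- bi_h _ _ _ _)).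
Qed.

HB.instance Definition _ E m :=
  GRing.isZmodMorphism.Build (tot_ob E m) (tot_ob E (m + 1)) (@tot_d E m)
    (@tot_d_additive E m).

Lemma tot_dd E m (a : tot_ob E m) : tot_d (tot_d a) = 0.
Proof.
apply: tot_ext => -[|n] k e; have -> : (0 : tot_ob E (m + 1 + 1)) _ k e = 0 by [].
  by rewrite /= raddfN /= bi_vv !oppr0.
rewrite /= raddfB /= bi_vv subr0.
have irr : tot_index_h (tot_index_v e) = tot_index_v (tot_index_h e).
  exact: bool_irrelevance.
case: n e irr => [|n] e irr /=.
  by rewrite raddfN -opprD irr addrC bi_hv oppr0.
by rewrite raddfB /= bi_hh sub0r -opprD irr addrC bi_hv oppr0.
Qed.

Definition totalization (E : bicomplex) : cochainComplex :=
  @CochainComplex (tot_ob E) (fun m => @tot_d E m) (@tot_dd E).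

Definition tot_fun (E E' : bicomplex) (f : bicomplexMap E E') (m : int)
  (a : tot_ob E m) : tot_ob E' m := fun n k e => f n k (a n k e).

Lemma tot_fun_additive E E' f m : zmod_morphism (@tot_fun E E' f m).
Proof. by move=> a b; apply: tot_ext => n k e; apply: raddfB. Qed.

HB.instance Definition _ E E' f m :=
  GRing.isZmodMorphism.Build (tot_ob E m) (tot_ob E' m) (@tot_fun E E' f m)
    (@tot_fun_additive E E' f m).

Lemma tot_fun_comm E E' (f : bicomplexMap E E') m (a : tot_ob E m) :
  tot_d (tot_fun f a) = tot_fun f (tot_d a).
Proof.
apply: tot_ext => -[|n] k e; rewrite /tot_fun /= ?raddfB ?raddfN /= ?bm_h bm_v //.
Qed.

Definition totalization_map (E E' : bicomplex) (f : bicomplexMap E E') :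
    cochainMap (totalization E) (totalization E') :=
  @CochainMap (totalization E) (totalization E') (fun m => @tot_fun E E' f m)
    (@tot_fun_comm E E' f).

Definition cs_h (C : cosimplicial) n k (x : C n k) : C n.+1 k :=
  \sum_(i < n.+2) cs_d C i k x *~ (-1) ^ (i%:Z + k).

Lemma cs_h_additive (C : cosimplicial) n k : zmod_morphism (@cs_h C n k).
Proof.
move=> x y; rewrite /cs_h -sumrB; apply: eq_bigr => i _.
by rewrite raddfB mulrzBl.
Qed.

HB.instance Definition _ (C : cosimplicial) n k :=
  GRing.isZmodMorphism.Build (C n k) (C n.+1 k) (@cs_h C n k)
    (@cs_h_additive C n k).

Lemma sum_coface_pairs (V : zmodType) (n : nat) (T : nat -> nat -> V) :
  (forall i j, (i < j <= n)%N -> T j i = - T i j.-1) ->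
  \sum_(j < n.+1) \sum_(i < n) T j i = 0.
Proof.
move=> TE.
under eq_bigr => j _ do rewrite (bigID (fun i : 'I_n => (i < j)%N)) /=.
rewrite big_split /= big_ord_recl big_pred0 ?add0r; last by move=> i; rewrite ltn0.
rewrite [X in _ + X]big_ord_recr /= [X in _ + (_ + X)]big_pred0 ?addr0; last first.
  by move=> i; rewrite ltn_ord.
rewrite [X in _ + X](exchange_big_dep xpredT) //= -big_split big1 //= => j _.
rewrite -[RHS](subrr (\sum_(i < n | (i <= j)%N) T i j)) addrC; congr (_ + _).
  by apply: eq_bigl => i; rewrite -leqNgt.
rewrite -sumrN; apply: eq_big => [i|i]; first by rewrite /bump /= add1n ltnS.
rewrite /bump /= add1n => ij; rewrite TE //; last by have := ltn_ord j; lia.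
Qed.

Lemma sign_shift (i : nat) (k : int) : (-1 : int) ^ (i%:Z + k) = (-1) ^+ i * (-1) ^ k.
Proof. by rewrite exprzDr. Qed.

Lemma cs_hh (C : cosimplicial) n k (x : C n k) : cs_h (cs_h x) = 0.
Proof.
rewrite /cs_h.
pose T (j i : nat) :=
  cs_d C (inord j) k (cs_d C (inord i) k x) *~ (-1) ^ (i%:Z + k) *~ (-1) ^ (j%:Z + k).
transitivity (\sum_(j < n.+3) \sum_(i < n.+2) T j i).
  apply: eq_bigr => j _; rewrite raddf_sum mulrz_suml; apply: eq_bigr => i _.
  by rewrite /T !inord_val raddfMz.
apply: sum_coface_pairs => i [|j] // /andP[ij jn].
rewrite /T cs_dd ?ij //= -mulrNz -!mulrzA; congr (_ *~ _).
rewrite !sign_shift exprS; ring.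
Qed.

Lemma cs_hv (C : cosimplicial) n k (x : C n (k + 1)) :
  ch_d (C n.+1) k (cs_h x) + cs_h (ch_d (C n) k x) = 0.
Proof.
rewrite /cs_h raddf_sum -big_split big1 // => i _ /=.
rewrite raddfMz /= cm_comm !sign_shift exprzDr // [(-1) ^ 1]/= mulrA mulrN1 mulrNz addNr //.
Qed.

Definition cs_bicomplex (C : cosimplicial) : bicomplex :=
  @Bicomplex (fun n k => C n k) (fun n k => @cs_h C n k) (fun n => ch_d (C n))
    (@cs_hh C) (fun n => @ch_dd (C n)) (@cs_hv C).

Lemma csm_h (C D : cosimplicial) (f : cosimplicialMap C D) n k (x : C n k) :
  cs_h (f n k x) = f n.+1 k (cs_h x).
Proof.
rewrite /cs_h raddf_sum; apply: eq_bigr => i _.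
by rewrite raddfMz /= csm_d.
Qed.

Definition cs_bicomplex_map (C D : cosimplicial) (f : cosimplicialMap C D) :
    bicomplexMap (cs_bicomplex C) (cs_bicomplex D) :=
  @BicomplexMap (cs_bicomplex C) (cs_bicomplex D) (fun n k => f n k)
    (@csm_h C D f) (fun n k x => cm_comm (f n) x).

Definition Tot (C : cosimplicial) : cochainComplex :=
  totalization (cs_bicomplex C).

Definition Tot_map (C D : cosimplicial) (f : cosimplicialMap C D) :
    cochainMap (Tot C) (Tot D) :=
  totalization_map (cs_bicomplex_map f).

(* ['S_q] permutes ['I_q] = {0, ..., q - 1}: the input called [i] in
   {1, ..., q} is the element [i - 1] of ['I_q]. *)

(* The extension of [s] to {0, ..., q + 1} that fixes [0] and [q + 1]. *)
Definition bar_perm q (s : 'S_q) : 'S_q.+2 :=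
  lift_perm ord0 ord0 (lift_perm ord_max ord_max s).

(* For 0 < i < q + 1, doubling the [i]-th input of [s] amounts to inserting a
   new input right after it, sent right after [s i]; in terms of ['I_q.+1] this
   new input has index [i] and its image has index [bar_perm s i]. *)
Definition perm_d q (i : 'I_q.+2) (s : 'S_q) : 'S_q.+1 :=
  if i == ord0 then lift_perm ord0 ord0 s
  else if i == ord_max then lift_perm ord_max ord_max s
  else lift_perm (inord i) (inord (bar_perm s i)) s.

Lemma perm_s_subproof q (i : 'I_q.+1) (s : 'S_q.+1) :
  injective (fun j : 'I_q => odflt j (unlift (s i) (s (lift i j)))).
Proof.
move=> j j'.
have neq_s (l : 'I_q) : s i != s (lift i l).
  by rewrite (inj_eq perm_inj) neq_lift.
have [l El El'] := unlift_some (neq_s j); have [l' Fl Fl'] := unlift_some (neq_s j').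
rewrite El' Fl' /= => ll'; apply: (@lift_inj _ i); apply: (@perm_inj _ s).
by rewrite El Fl ll'.
Qed.

(* Deletes the input [i] of ['I_q.+1], that is [i + 1] in the numbering from 1,
   and its image. *)
Definition perm_s q (i : 'I_q.+1) (s : 'S_q.+1) : 'S_q :=
  perm (@perm_s_subproof q i s).

(* [bar_perm] on natural numbers, used to check the cosimplicial identities. *)
Definition bar_nat q (s : 'S_q) (j : nat) : nat := bar_perm s (inord j).

Lemma bar_nat_ord q (s : 'S_q) (i : 'I_q.+2) : bar_nat s i = bar_perm s i.
Proof. by rewrite /bar_nat inord_val. Qed.

Lemma inord_bar q (s : 'S_q) (j : nat) :
  inord (bar_nat s j) = bar_perm s (inord j).
Proof. exact: inord_val. Qed.

Lemma bar_nat_le q (s : 'S_q) j : (bar_nat s j <= q.+1)%N.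
Proof. by rewrite -ltnS ltn_ord. Qed.

Lemma bar_nat_inj q (s : 'S_q) j j' : (j <= q.+1)%N -> (j' <= q.+1)%N ->
  bar_nat s j = bar_nat s j' -> j = j'.
Proof.
move=> jq jq' /val_inj/perm_inj/(congr1 (@nat_of_ord _)).
by rewrite !inordK.
Qed.

Lemma bar_nat0 q (s : 'S_q) : bar_nat s 0 = 0%N.
Proof.
rewrite /bar_nat (_ : inord 0 = ord0) ?lift_perm_id //.
by apply: val_inj; rewrite /= inordK.
Qed.

Lemma bar_nat_max q (s : 'S_q) : bar_nat s q.+1 = q.+1.
Proof.
rewrite /bar_nat (_ : inord q.+1 = lift ord0 ord_max); last first.
  by apply: val_inj; rewrite /= inordK.
by rewrite lift_perm_lift lift_perm_id.
Qed.

Lemma bar_natS q (s : 'S_q) (j : 'I_q) : bar_nat s j.+1 = (s j).+1.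
Proof.
rewrite /bar_nat (_ : inord j.+1 = lift ord0 (lift ord_max j)).
  by rewrite !lift_perm_lift lift0 lift_max.
by apply: ord_inj; rewrite lift0 lift_max inordK // !ltnS ltnW.
Qed.

Lemma eq_bar_nat q (s t : 'S_q) :
  (forall j, (0 < j <= q)%N -> bar_nat s j = bar_nat t j) -> s = t.
Proof.
move=> st; apply/permP => j; apply: val_inj; apply: succn_inj.
by rewrite -!bar_natS st //= ltn_ord.
Qed.

Lemma bar_nat_lift_perm q (i k : 'I_q.+1) (s : 'S_q) j : (0 < j <= q.+1)%N ->
  bar_nat (lift_perm i k s) j =
  if j == i.+1 then k.+1 else bump k.+1 (bar_nat s (unbump i.+1 j)).
Proof.
case: j => [|j] // /= jq; pose o := Ordinal jq.
rewrite -[j]/(val o) bar_natS eqSS; case: (unliftP i o) => [l|] ->.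
  rewrite lift_perm_lift /= eq_sym (negbTE (neq_bump _ _)) unbumpS.
  by rewrite bumpK (bar_natS s l) bumpS.
by rewrite eqxx lift_perm_id.
Qed.

Lemma bar_nat_d q (i : 'I_q.+2) (s : 'S_q) j : (j <= q.+2)%N ->
  bar_nat (perm_d i s) j =
  if j == i.+1 then (bar_nat s i).+1
  else bump (bar_nat s i).+1 (bar_nat s (unbump i.+1 j)).
Proof.
case: j => [|j] jq; first by rewrite !bar_nat0.
have [->|neq_j] := eqVneq j q.+1.
  rewrite bar_nat_max eqSS; case: eqVneq => [<-|neq_i]; first by rewrite bar_nat_max.
  have i_lt : (i < q.+1)%N by have := ltn_ord i; lia.
  have -> : unbump i.+1 q.+2 = q.+1 by rewrite /unbump; lia.
  have : bar_nat s i != q.+1.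
    apply/eqP => si; have := @bar_nat_inj q s i q.+1.
    by rewrite bar_nat_max => /(_ (ltnW i_lt) (leqnn _) si); lia.
  by have := bar_nat_le s i; rewrite bar_nat_max /bump; lia.
have jq' : (0 < j.+1 <= q.+1)%N by lia.
have [bar_lt|] := boolP (i == ord_max).
  rewrite /perm_d (eqP bar_lt) eqxx /=.
  rewrite bar_nat_lift_perm //= bar_nat_max !eqSS (negPf neq_j).
  have -> : unbump q.+2 j.+1 = j.+1 by rewrite /unbump; lia.
  have bar_j := bar_nat_le s j.+1.
  have [->|neq_jq] := eqVneq j q; first by rewrite bar_nat_max /bump; lia.
  have -> : unbump q.+1 j.+1 = j.+1 by rewrite /unbump; lia.
  have : bar_nat s j.+1 != q.+1.
    apply/eqP => sj; have := @bar_nat_inj q s j.+1 q.+1.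
    by rewrite bar_nat_max => /(_ _ _ sj); lia.
  by rewrite /bump; lia.
rewrite /perm_d => imax; rewrite (negPf imax).
have i_lt : (i < q.+1)%N by move: imax; rewrite -val_eqE /=; have := ltn_ord i; lia.
case: eqVneq => [->|i0]; first by rewrite bar_nat_lift_perm // bar_nat0.
have bar_lt : (bar_perm s i < q.+1)%N.
  have := ltn_ord (bar_perm s i); rewrite -bar_nat_ord ltnS leq_eqVlt => /predU1P[si|//].
  have := @bar_nat_inj q s i q.+1.
  by rewrite bar_nat_max => /(_ (ltnW i_lt) (leqnn _) si); lia.
by rewrite bar_nat_lift_perm // !inordK // bar_nat_ord.
Qed.

Lemma bar_nat_s q (i : 'I_q.+1) (s : 'S_q.+1) j : (j <= q.+1)%N ->
  bar_nat (perm_s i s) j =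
  unbump (bar_nat s i.+1) (bar_nat s (bump i.+1 j)).
Proof.
have bar_i : (bar_nat s i.+1 = (s i).+1) by rewrite bar_natS.
rewrite {}bar_i; case: j => [|j] jq.
  by rewrite !bar_nat0.
have [->|neq_j] := eqVneq j q.
  have -> : bump i.+1 q.+1 = q.+2 by rewrite /bump; have := ltn_ord i; lia.
  by rewrite !bar_nat_max /unbump; have := ltn_ord (s i); lia.
have {neq_j}jq : (j < q)%N by lia.
pose o := Ordinal jq; rewrite -[j]/(val o) bar_natS permE bumpS.
rewrite -[bump i o]/(val (lift i o)) bar_natS unbumpS.
have neq_s : s i != s (lift i o) by rewrite (inj_eq perm_inj) neq_lift.
by have [l -> ->] := unlift_some neq_s; rewrite /= bumpK.
Qed.

Lemma nat_cmp (a b : nat) : [\/ (a < b)%N, a = b | (b < a)%N].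
Proof. by case: (ltngtP a b); [constructor 1|constructor 3|constructor 2]. Qed.

Lemma unbump_lo h k : (k <= h)%N -> unbump h k = k.
Proof. by rewrite /unbump; lia. Qed.
Lemma unbump_hi h k : (h < k)%N -> unbump h k = k.-1.
Proof. by rewrite /unbump; lia. Qed.
Lemma bump_lo h k : (k < h)%N -> bump h k = k.
Proof. by rewrite /bump; lia. Qed.
Lemma bump_hi h k : (h <= k)%N -> bump h k = k.+1.
Proof. by rewrite /bump; lia. Qed.

Local Ltac index_only t :=
  lazymatch t with
  | context [bar_nat] => fail
  | context [bump] => fail
  | context [unbump] => fail
  | _ => idtac
  end.
Local Ltac no_bump t :=
  lazymatch t with
  | context [bump] => fail
  | context [unbump] => fail
  | _ => idtac
  end.
Local Ltac eval_bar :=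
  repeat match goal with
  | |- context [unbump ?h ?k] => index_only h; index_only k;
    first [ rewrite (@unbump_lo h k); last by lia
          | rewrite (@unbump_hi h k); last by lia ]; rewrite ?[_.+1.-1]/=
  | |- context [bump ?h ?k] => index_only h; index_only k;
    first [ rewrite (@bump_lo h k); last by lia
          | rewrite (@bump_hi h k); last by lia ]
  | |- context [if ?a == ?b :> nat then _ else _] => index_only a; index_only b;
    first [ rewrite (_ : (a == b :> nat) = true); last by lia
          | rewrite (_ : (a == b :> nat) = false); last by lia ]
  end.
Local Ltac neq_bar :=
  repeat match goal with
  | |- context [bar_nat ?s ?x] =>
    match goal with
    | |- context [bar_nat s ?y] =>
      tryif constr_eq x y then fail else
      first [replace (bar_nat s y) with (bar_nat s x) by (congr (bar_nat s _); lia) |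
      lazymatch goal with
      | _ : bar_nat s x <> bar_nat s y |- _ => fail
      | _ : bar_nat s y <> bar_nat s x |- _ => fail
      | _ => assert (bar_nat s x <> bar_nat s y) by (move=> /bar_nat_inj; lia)
      end]
    end
  end.
Local Ltac bar_atoms :=
  repeat match goal with
  | s : _ |- _ =>
    match goal with
    | |- context [bar_nat s ?x] =>
      let y := fresh "y" in set (y := bar_nat s x) in *; clearbody y
    end
  end.
Local Ltac split_bump :=
  repeat match goal with
  | |- context [bump ?h ?k] => no_bump h; no_bump k;
    let H := fresh in case: (leqP h k) => H;
    [rewrite (bump_hi H) | rewrite (bump_lo H)]
  | |- context [unbump ?h ?k] => no_bump h; no_bump k;
    let H := fresh in case: (leqP k h) => H;
    [rewrite (unbump_lo H) | rewrite (unbump_hi H)]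
  end.
Local Ltac solve_bar :=
  eval_bar; try reflexivity; neq_bar; bar_atoms; split_bump; lia.

Lemma perm_dd q (s : 'S_q) i j : (i < j <= q.+2)%N ->
  perm_d (inord j) (perm_d (inord i) s) =
  perm_d (inord i) (perm_d (inord j.-1) s).
Proof.
case: j => [|j] // ij; apply: eq_bar_nat => l lq /=.
rewrite !(bar_nat_d, inordK); try by rewrite /unbump; lia.
have [ij'|ij'|ij'] := nat_cmp i j; have [l1|l1|l1] := nat_cmp l i.+1;
  have [l2|l2|l2] := nat_cmp l j.+2; try lia; try subst l; try subst i; first [solve_bar | idtac; match goal with |- ?G => idtac G end].
Qed.

Lemma perm_ss q (s : 'S_q.+2) i j : (i <= j <= q)%N ->
  perm_s (inord j) (perm_s (inord i) s) =
  perm_s (inord i) (perm_s (inord j.+1) s).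
Proof.
move=> ij; apply: eq_bar_nat => l lq /=.
rewrite !(bar_nat_s, inordK); try by rewrite /bump; lia.
have [l1|l1|l1] := nat_cmp l i.+1;
  have [l2|l2|l2] := nat_cmp l j.+1; try lia; try subst l; first [solve_bar | idtac; match goal with |- ?G => idtac G end].
Qed.

Lemma perm_sd_lt q (s : 'S_q.+1) i j : (i < j <= q.+1)%N ->
  perm_s (inord j) (perm_d (inord i) s) =
  perm_d (inord i) (perm_s (inord j.-1) s).
Proof.
case: j => [|j] // ij; apply: eq_bar_nat => l lq /=.
rewrite !(bar_nat_s, bar_nat_d, inordK); try by rewrite /bump /unbump; lia.
have [l1|l1|l1] := nat_cmp l i.+1;
  have [l2|l2|l2] := nat_cmp l j.+2; try lia; try subst l; first [solve_bar | idtac; match goal with |- ?G => idtac G end].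
Qed.

Lemma perm_sd_id q (s : 'S_q) i j : (j <= q)%N -> (i == j) || (i == j.+1) ->
  perm_s (inord j) (perm_d (inord i) s) = s.
Proof.
move=> jq ij; apply: eq_bar_nat => l lq /=.
rewrite !(bar_nat_s, bar_nat_d, inordK); try by rewrite /bump /unbump; lia.
case/orP: ij => /eqP ->; have [l1|l1|l1] := nat_cmp l j.+1; try subst l; first [solve_bar | idtac; match goal with |- ?G => idtac G end].
Qed.

Lemma perm_sd_gt q (s : 'S_q.+1) i j : (j.+1 < i <= q.+2)%N ->
  perm_s (inord j) (perm_d (inord i) s) =
  perm_d (inord i.-1) (perm_s (inord j) s).
Proof.
case: i => [|i] // ij; apply: eq_bar_nat => l lq /=.
rewrite !(bar_nat_s, bar_nat_d, inordK); try by rewrite /bump /unbump; lia.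
have [l1|l1|l1] := nat_cmp l i.+1;
  have [l2|l2|l2] := nat_cmp l j.+1; try lia; try subst l; first [solve_bar | idtac; match goal with |- ?G => idtac G end].
Qed.

Section DirectSum.
Variables (S T : finType) (A B : zmodType).

(* The element [a] of the summand with index [s]. *)
Definition summand (a : A) (s : S) : {ffun S -> A} :=
  [ffun t => if t == s then a else 0].

Lemma summand_additive s : zmod_morphism (summand^~ s).
Proof.
move=> a b; apply/ffunP => t; rewrite !ffunE.
by case: ifP => _ //; rewrite subr0.
Qed.

Lemma summand0 s : summand 0 s = 0.
Proof. by apply/ffunP => t; rewrite !ffunE if_same. Qed.

Lemma sum_summand (x : {ffun S -> A}) : x = \sum_s summand (x s) s.
Proof.
apply/ffunP => t; rewrite sum_ffunE (bigD1 t) //= ffunE eqxx big1 ?addr0 // => s.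
by rewrite ffunE eq_sym => /negPf ->.
Qed.

Lemma summand_ind (P : {ffun S -> A} -> Prop) :
  P 0 -> (forall x y, P x -> P y -> P (x + y)) -> (forall a s, P (summand a s)) ->
  forall x, P x.
Proof. by move=> P0 PD Ps x; rewrite [x]sum_summand; apply: big_ind. Qed.

End DirectSum.

Section DirectSumMap.
Variables (S T : finType) (A B : zmodType).
Variables (f : S -> {additive A -> B}) (g : S -> T).

(* The homomorphism that sends [(a, s)] to [(f s a, g s)]. *)
Definition dsum_map (x : {ffun S -> A}) : {ffun T -> B} :=
  \sum_s summand (f s (x s)) (g s).

Lemma dsum_map_additive : zmod_morphism dsum_map.
Proof.
move=> x y; rewrite /dsum_map -sumrB; apply: eq_bigr => s _.
by rewrite !ffunE -summand_additive raddfB.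
Qed.

HB.instance Definition _ :=
  GRing.isZmodMorphism.Build {ffun S -> A} {ffun T -> B} dsum_map dsum_map_additive.

Lemma dsum_map_summand a s : dsum_map (summand a s) = summand (f s a) (g s).
Proof.
rewrite /dsum_map (bigD1 s) //= ffunE eqxx big1 ?addr0 // => t /negPf ts.
by rewrite ffunE ts raddf0; apply/ffunP => u; rewrite !ffunE if_same.
Qed.

End DirectSumMap.

Definition FS_ob (C : cosimplicial) q k : zmodType := {ffun 'S_q -> C q k}.

Definition FS_bd (C : cosimplicial) q k :
    {additive FS_ob C q (k + 1) -> FS_ob C q k} :=
  dsum_map (fun=> ch_d (C q) k) id.

Definition FS_d (C : cosimplicial) q (i : 'I_q.+2) k :
    {additive FS_ob C q k -> FS_ob C q.+1 k} :=
  dsum_map (fun s : 'S_q => cs_d C (bar_perm s i) k) (perm_d i).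

(* As [s] permutes ['I_q.+1] = {0, ..., q}, the index
   [s (i + 1) - 1] of the numbering from 1 is [s i]. *)
Definition FS_s (C : cosimplicial) q (i : 'I_q.+1) k :
    {additive FS_ob C q.+1 k -> FS_ob C q k} :=
  dsum_map (fun s : 'S_q.+1 => cs_s C (s i) k) (perm_s i).

Section FS.
Variable C : cosimplicial.

Lemma FS_bd_bd q k (x : FS_ob C q (k + 1 + 1)) : FS_bd C q k (FS_bd C q (k + 1) x) = 0.
Proof.
elim/summand_ind: x => [|x y IHx IHy|a s]; first by rewrite !raddf0.
  by rewrite !raddfD /= IHx IHy addr0.
by rewrite /= !dsum_map_summand ch_dd summand0.
Qed.

Definition FS_complex q : chainComplex :=
  @ChainComplex (FS_ob C q) (FS_bd C q) (@FS_bd_bd q).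

Lemma FS_d_bd q (i : 'I_q.+2) k (x : FS_ob C q (k + 1)) :
  FS_bd C q.+1 k (FS_d C i (k + 1) x) = FS_d C i k (FS_bd C q k x).
Proof.
elim/summand_ind: x => [|x y IHx IHy|a s]; first by rewrite !raddf0.
  by rewrite !raddfD /= IHx IHy.
by rewrite /= !dsum_map_summand cm_comm.
Qed.

Lemma FS_s_bd q (i : 'I_q.+1) k (x : FS_ob C q.+1 (k + 1)) :
  FS_bd C q k (FS_s C i (k + 1) x) = FS_s C i k (FS_bd C q.+1 k x).
Proof.
elim/summand_ind: x => [|x y IHx IHy|a s]; first by rewrite !raddf0.
  by rewrite !raddfD /= IHx IHy.
by rewrite /= !dsum_map_summand cm_comm.
Qed.

Definition FS_coface q (i : 'I_q.+2) : chainMap (FS_complex q) (FS_complex q.+1) :=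
  @ChainMap (FS_complex q) (FS_complex q.+1) (FS_d C i) (FS_d_bd i).

Definition FS_codegeneracy q (i : 'I_q.+1) :
    chainMap (FS_complex q.+1) (FS_complex q) :=
  @ChainMap (FS_complex q.+1) (FS_complex q) (FS_s C i) (FS_s_bd i).

Lemma bar_permE q (s : 'S_q) (i : 'I_q.+2) : bar_perm s i = inord (bar_nat s i).
Proof. by rewrite bar_nat_ord inord_val. Qed.

Lemma perm_bar q (s : 'S_q.+1) (i : 'I_q.+1) : s i = inord (bar_nat s i.+1).-1.
Proof. by rewrite bar_natS inord_val. Qed.

Lemma bar_nat_gt0 q (s : 'S_q) j : (0 < j <= q.+1)%N -> (0 < bar_nat s j)%N.
Proof.
move=> j0; rewrite lt0n; apply/eqP; rewrite -(bar_nat0 s) => /bar_nat_inj; lia.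
Qed.

Lemma bar_nat_lt q (s : 'S_q) j : (j <= q)%N -> (bar_nat s j <= q)%N.
Proof.
move=> jq; have := bar_nat_le s j; rewrite leq_eqVlt => /predU1P[|//].
rewrite -[X in _ = X](bar_nat_max s) => /bar_nat_inj; lia.
Qed.

Lemma FS_dd q k (x : FS_complex q k) i j : (i < j <= q.+2)%N ->
  FS_coface (inord j) k (FS_coface (inord i) k x) =
  FS_coface (inord i) k (FS_coface (inord j.-1) k x).
Proof.
move=> ij; elim/summand_ind: x => [|x y IHx IHy|a s]; first by rewrite !raddf0.
  by rewrite !raddfD /= IHx IHy.
rewrite /= !dsum_map_summand /= perm_dd //; congr (summand _ _).
case: j ij => [|j] // ij; rewrite !bar_permE !(bar_nat_d, inordK) /=; try by lia.
have := bar_nat_le s i; have := bar_nat_le s j.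
have [ij'|ij'|ij'] := nat_cmp i j; try lia; last first.
  subst i; eval_bar; bar_atoms; split_bump => ? ?; try lia.
  by rewrite [LHS]cs_dd //; lia.
eval_bar; neq_bar; bar_atoms; split_bump => ? ?; try lia.
  by rewrite [LHS]cs_dd //; lia.
by rewrite [RHS]cs_dd //; lia.
Qed.

Lemma FS_ss q k (x : FS_complex q.+2 k) i j : (i <= j <= q)%N ->
  FS_codegeneracy (inord j) k (FS_codegeneracy (inord i) k x) =
  FS_codegeneracy (inord i) k (FS_codegeneracy (inord j.+1) k x).
Proof.
move=> ij; elim/summand_ind: x => [|x y IHx IHy|a s]; first by rewrite !raddf0.
  by rewrite !raddfD /= IHx IHy.
rewrite /= !dsum_map_summand /= perm_ss //; congr (summand _ _).
rewrite !perm_bar !(bar_nat_s, inordK) /=; try by lia.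
have : (0 < bar_nat s i.+1)%N by apply: bar_nat_gt0; lia.
have : (0 < bar_nat s j.+2)%N by apply: bar_nat_gt0; lia.
have : (bar_nat s i.+1 <= q.+2)%N by apply: bar_nat_lt; lia.
have : (bar_nat s j.+2 <= q.+2)%N by apply: bar_nat_lt; lia.
eval_bar; neq_bar; bar_atoms; split_bump => ? ? ? ?; try lia.
  rewrite [RHS]cs_ss; last by lia.
  by congr (cs_s _ (inord _) _ (cs_s _ (inord _) _ _)); lia.
rewrite [LHS]cs_ss; last by lia.
by congr (cs_s _ (inord _) _ (cs_s _ (inord _) _ _)); lia.
Qed.

Lemma FS_sd_lt q k (x : FS_complex q.+1 k) i j : (i < j <= q.+1)%N ->
  FS_codegeneracy (inord j) k (FS_coface (inord i) k x) =
  FS_coface (inord i) k (FS_codegeneracy (inord j.-1) k x).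
Proof.
move=> ij; elim/summand_ind: x => [|x y IHx IHy|a s]; first by rewrite !raddf0.
  by rewrite !raddfD /= IHx IHy.
rewrite /= !dsum_map_summand /= perm_sd_lt //; congr (summand _ _).
case: j ij => [|j] // ij.
rewrite !bar_permE !perm_bar !(bar_nat_s, bar_nat_d, inordK) /=; try by lia.
have := bar_nat_le s i.
have : (bar_nat s j.+1 <= q.+1)%N by apply: bar_nat_lt; lia.
have : (0 < bar_nat s j.+1)%N by apply: bar_nat_gt0; lia.
eval_bar; neq_bar; bar_atoms; split_bump => ? ? ?; try lia.
  by rewrite cs_sd_lt //; lia.
by rewrite cs_sd_gt //; lia.
Qed.

Lemma FS_sd_id q k (x : FS_complex q k) i j : (j <= q)%N ->
  (i == j) || (i == j.+1) ->
  FS_codegeneracy (inord j) k (FS_coface (inord i) k x) = x.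
Proof.
move=> jq ij; elim/summand_ind: x => [|x y IHx IHy|a s]; first by rewrite !raddf0.
  by rewrite !raddfD /= IHx IHy.
rewrite /= !dsum_map_summand /= perm_sd_id //; congr (summand _ _).
rewrite !bar_permE !perm_bar !(bar_nat_s, bar_nat_d, inordK) /=; try by lia.
case/orP: ij => /eqP ->;
  have := bar_nat_lt s jq; have := bar_nat_le s j.+1;
  have : (0 < bar_nat s j.+1)%N by apply: bar_nat_gt0; lia.
  by eval_bar; bar_atoms; split_bump => ? ? ?; try lia; rewrite cs_sd_id //=; lia.
by eval_bar; bar_atoms; split_bump => ? ? ?; try lia; rewrite cs_sd_id //=; lia.
Qed.

Lemma FS_sd_gt q k (x : FS_complex q.+1 k) i j : (j.+1 < i <= q.+2)%N ->
  FS_codegeneracy (inord j) k (FS_coface (inord i) k x) =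
  FS_coface (inord i.-1) k (FS_codegeneracy (inord j) k x).
Proof.
move=> ij; elim/summand_ind: x => [|x y IHx IHy|a s]; first by rewrite !raddf0.
  by rewrite !raddfD /= IHx IHy.
rewrite /= !dsum_map_summand /= perm_sd_gt //; congr (summand _ _).
case: i ij => [|i] // ij.
rewrite !bar_permE !perm_bar !(bar_nat_s, bar_nat_d, inordK) /=; try by lia.
have := bar_nat_le s i.+1.
have : (bar_nat s j.+1 <= q.+1)%N by apply: bar_nat_lt; lia.
have : (0 < bar_nat s j.+1)%N by apply: bar_nat_gt0; lia.
eval_bar; neq_bar; bar_atoms; split_bump => ? ? ?; try lia.
  by rewrite cs_sd_lt //; lia.
by rewrite cs_sd_gt //; lia.
Qed.

Definition FS : cosimplicial :=
  @Cosimplicial FS_complex FS_coface FS_codegeneracy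
    FS_dd FS_ss FS_sd_lt FS_sd_id FS_sd_gt.

End FS.

Section FSMap.
Variables (C D : cosimplicial) (f : cosimplicialMap C D).

Definition FS_map_fun q k : {additive FS_ob C q k -> FS_ob D q k} :=
  dsum_map (fun=> f q k) id.

Lemma FS_map_bd q k (x : FS_ob C q (k + 1)) :
  FS_bd D q k (FS_map_fun q (k + 1) x) = FS_map_fun q k (FS_bd C q k x).
Proof.
elim/summand_ind: x => [|x y IHx IHy|a s]; first by rewrite !raddf0.
  by rewrite !raddfD /= IHx IHy.
by rewrite /= !dsum_map_summand cm_comm.
Qed.

Definition FS_map_level q : chainMap (FS C q) (FS D q) :=
  @ChainMap (FS C q) (FS D q) (FS_map_fun q) (@FS_map_bd q).

Lemma FS_map_d q (i : 'I_q.+2) k (x : FS C q k) :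
  FS_map_level q.+1 k (cs_d (FS C) i k x) = cs_d (FS D) i k (FS_map_level q k x).
Proof.
elim/summand_ind: x => [|x y IHx IHy|a s]; first by rewrite !raddf0.
  by rewrite !raddfD /= IHx IHy.
by rewrite /= !dsum_map_summand csm_d.
Qed.

Lemma FS_map_s q (i : 'I_q.+1) k (x : FS C q.+1 k) :
  FS_map_level q k (cs_s (FS C) i k x) = cs_s (FS D) i k (FS_map_level q.+1 k x).
Proof.
elim/summand_ind: x => [|x y IHx IHy|a s]; first by rewrite !raddf0.
  by rewrite !raddfD /= IHx IHy.
by rewrite /= !dsum_map_summand csm_s.
Qed.

Definition FS_map : cosimplicialMap (FS C) (FS D) :=
  @CosimplicialMap (FS C) (FS D) FS_map_level FS_map_d FS_map_s.

End FSMap.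

Section Iota.
Variable C : cosimplicial.

Definition iota_fun q k (a : C q k) : FS_ob C q k := summand a 1%g.

Lemma iota_additive q k : zmod_morphism (@iota_fun q k).
Proof. exact: summand_additive. Qed.

HB.instance Definition _ q k :=
  GRing.isZmodMorphism.Build (C q k) (FS_ob C q k) (@iota_fun q k)
    (@iota_additive q k).

Lemma iota_bd q k (a : C q (k + 1)) :
  ch_d (FS C q) k (iota_fun a) = iota_fun (ch_d (C q) k a).
Proof. exact: dsum_map_summand. Qed.

Definition iota_level q : chainMap (C q) (FS C q) :=
  @ChainMap (C q) (FS C q) (@iota_fun q) (@iota_bd q).

Lemma bar_perm1 q : bar_perm (1%g : 'S_q) = 1%g.
Proof. by rewrite /bar_perm !lift_perm1. Qed.

Lemma perm_d1 q (i : 'I_q.+2) : perm_d i (1%g : 'S_q) = 1%g.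
Proof.
by rewrite /perm_d bar_perm1 perm1; do 2?[case: ifP => _]; rewrite lift_perm1.
Qed.

Lemma perm_s1 q (i : 'I_q.+1) : perm_s i (1%g : 'S_q.+1) = 1%g.
Proof. by apply/permP => j; rewrite permE !perm1 liftK. Qed.

Lemma iota_d q (i : 'I_q.+2) k (a : C q k) :
  iota_level q.+1 k (cs_d C i k a) = cs_d (FS C) i k (iota_level q k a).
Proof.
by rewrite /= /iota_fun /FS_d dsum_map_summand bar_perm1 perm_d1 perm1.
Qed.

Lemma iota_s q (i : 'I_q.+1) k (a : C q.+1 k) :
  iota_level q k (cs_s C i k a) = cs_s (FS C) i k (iota_level q.+1 k a).
Proof. by rewrite /= /iota_fun /FS_s dsum_map_summand perm_s1 perm1. Qed.

Definition iota_FS : cosimplicialMap C (FS C) :=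
  @CosimplicialMap C (FS C) iota_level iota_d iota_s.

End Iota.

Section SignMap.
Variable C : cosimplicial.

(* [(-1) ^+ s] is the signature of the permutation [s]. *)
Definition sgn_fun q k (x : FS_ob C q k) : C q k :=
  \sum_(s : 'S_q) x s *~ (-1) ^+ s.

Lemma sgn_fun_additive q k : zmod_morphism (@sgn_fun q k).
Proof.
move=> x y; rewrite /sgn_fun -sumrB; apply: eq_bigr => s _.
by rewrite !ffunE mulrzBl.
Qed.

HB.instance Definition _ q k :=
  GRing.isZmodMorphism.Build (FS_ob C q k) (C q k) (@sgn_fun q k)
    (@sgn_fun_additive q k).

Lemma sgn_fun_summand q k (a : C q k) (s : 'S_q) :
  sgn_fun (summand a s) = a *~ (-1) ^+ s.
Proof.
rewrite /sgn_fun (bigD1 s) //= ffunE eqxx big1 ?addr0 // => t /negPf ts.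
by rewrite ffunE ts mul0rz.
Qed.

Lemma odd_perm_d q (i : 'I_q.+2) (s : 'S_q) :
  perm_d i s = odd i (+) odd (bar_perm s i) (+) s :> bool.
Proof.
rewrite /perm_d -bar_nat_ord; case: eqVneq => [->|i0].
  by rewrite odd_lift_perm bar_nat0.
case: eqVneq => [->|imax]; first by rewrite odd_lift_perm bar_nat_max !addbb.
have i_lt : (i <= q)%N by move: imax; rewrite -val_eqE /=; have := ltn_ord i; lia.
by rewrite odd_lift_perm !inordK // ltnS -?bar_nat_ord bar_nat_lt.
Qed.

Lemma sgn_h q k (x : FS_ob C q k) :
  cs_h (sgn_fun x) = sgn_fun (cs_h (x : FS C q k)).
Proof.
elim/summand_ind: x => [|x y IHx IHy|a s]; first by rewrite !raddf0.
  by rewrite !raddfD /= IHx IHy.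
rewrite sgn_fun_summand raddf_sum /cs_h (reindex_inj (@perm_inj _ (bar_perm s))) /=.
apply: eq_bigr => i _; rewrite !raddfMz /= /FS_d dsum_map_summand sgn_fun_summand.
rewrite -!mulrzA; congr (_ *~ _).
rewrite !sign_shift !mulrA; congr (_ * _); rewrite odd_perm_d !signr_addb !signr_odd.
by rewrite mulrC [RHS]mulrC !mulrA -expr2 sqrr_sign mul1r.
Qed.

Lemma sgn_v q k (x : FS_ob C q (k + 1)) :
  ch_d (C q) k (sgn_fun x) = sgn_fun (ch_d (FS C q) k x).
Proof.
elim/summand_ind: x => [|x y IHx IHy|a s]; first by rewrite !raddf0.
  by rewrite !raddfD /= IHx IHy.
by rewrite /= /FS_bd dsum_map_summand !sgn_fun_summand raddfMz.
Qed.

Definition sgn_map : bicomplexMap (cs_bicomplex (FS C)) (cs_bicomplex C) :=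
  @BicomplexMap (cs_bicomplex (FS C)) (cs_bicomplex C) (@sgn_fun) sgn_h sgn_v.

End SignMap.

(* Main.v *)
(* A natural operation on permuted summands [C^p -> C^q] can be coned off:
   evaluate it on the decalage [dec C] (with [(dec C)^q = C^(q+1)], cofaces
   [d_(i+1)] and codegeneracies [s_(i+1)]), precede it by the projection
   [FS_cone] onto the summands [1 x s] and follow it by [s_0]. This is the
   extra degeneracy that contracts the complexes of natural operations, so the
   method of acyclic models yields a homotopy by recursion on the degree,
   simultaneously for all [C]: [H^(q+1)] is the cone of [iota m - id - d H^q],
   up to the sign [(-1)^k]. *)

Require Import Defs.
From HB Require Import structures.
From mathcomp Require Import all_boot all_order all_algebra all_fingroup zify.
Set Implicit Arguments.
Unset Strict Implicit.
Unset Printing Implicit Defensive.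
Import GRing.Theory.
Local Open Scope ring_scope.

(** * The decalage and the omitted coface [d_0] *)

Lemma inord_ord0 n : inord 0 = ord0 :> 'I_n.+1.
Proof. by apply: val_inj; rewrite /= inordK. Qed.

Lemma lift0_inord n i : (i < n.+1)%N -> lift ord0 (inord i : 'I_n.+1) = inord i.+1.
Proof. by move=> lin; apply: val_inj; rewrite /= inordK // inordK. Qed.

Section Decalage.
Variable C : cosimplicial.

Lemma dec_dd q k (x : C q.+1 k) i j : (i < j <= q.+2)%N ->
  cs_d C (lift ord0 (inord j : 'I_q.+3)) k (cs_d C (lift ord0 (inord i)) k x) =
  cs_d C (lift ord0 (inord i)) k (cs_d C (lift ord0 (inord j.-1)) k x).
Proof.
by case: j => // j ij; do 4?[rewrite lift0_inord; last by lia]; rewrite cs_dd //; lia.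
Qed.

Lemma dec_ss q k (x : C q.+3 k) i j : (i <= j <= q)%N ->
  cs_s C (lift ord0 (inord j : 'I_q.+1)) k (cs_s C (lift ord0 (inord i)) k x) =
  cs_s C (lift ord0 (inord i)) k (cs_s C (lift ord0 (inord j.+1)) k x).
Proof. by move=> ij; do 4?[rewrite lift0_inord; last by lia]; rewrite cs_ss //; lia. Qed.

Lemma dec_sd_lt q k (x : C q.+2 k) i j : (i < j <= q.+1)%N ->
  cs_s C (lift ord0 (inord j : 'I_q.+2)) k (cs_d C (lift ord0 (inord i)) k x) =
  cs_d C (lift ord0 (inord i)) k (cs_s C (lift ord0 (inord j.-1)) k x).
Proof.
by case: j => // j ij; do 4?[rewrite lift0_inord; last by lia]; rewrite cs_sd_lt //; lia.
Qed.

Lemma dec_sd_id q k (x : C q.+1 k) i j : (j <= q)%N ->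
  (i == j) || (i == j.+1) ->
  cs_s C (lift ord0 (inord j : 'I_q.+1)) k (cs_d C (lift ord0 (inord i)) k x) = x.
Proof. by move=> jq ij; do 4?[rewrite lift0_inord; last by lia]; rewrite cs_sd_id //; lia. Qed.

Lemma dec_sd_gt q k (x : C q.+2 k) i j : (j.+1 < i <= q.+2)%N ->
  cs_s C (lift ord0 (inord j : 'I_q.+2)) k (cs_d C (lift ord0 (inord i)) k x) =
  cs_d C (lift ord0 (inord i.-1)) k (cs_s C (lift ord0 (inord j)) k x).
Proof.
by case: i => // i ij; do 4?[rewrite lift0_inord; last by lia]; rewrite cs_sd_gt //; lia.
Qed.

Definition dec : cosimplicial :=
  @Cosimplicial (fun q => C q.+1) (fun q i => cs_d C (lift ord0 i))
    (fun q i => cs_s C (lift ord0 i)) dec_dd dec_ss dec_sd_lt dec_sd_id dec_sd_gt.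

Lemma coface0_d q (i : 'I_q.+2) k (x : C q k) :
  cs_d C ord0 k (cs_d C i k x) = cs_d dec i k (cs_d C ord0 k x).
Proof.
have iq := ltn_ord i.
by rewrite /= -(inord_val i) lift0_inord // -!inord_ord0 [RHS]cs_dd //; lia.
Qed.

Lemma coface0_s q (i : 'I_q.+1) k (x : C q.+1 k) :
  cs_d C ord0 k (cs_s C i k x) = cs_s dec i k (cs_d C ord0 k x).
Proof.
have iq := ltn_ord i.
by rewrite /= -(inord_val i) lift0_inord // -!inord_ord0 [RHS]cs_sd_lt //; lia.
Qed.

(** The coface left out of [dec C] commutes with all structure maps by the cosimplicial identities.
    Having it as a cosimplicial map allows naturality in [C] to be applied to it. *)
Definition coface0 : cosimplicialMap C dec :=
  @CosimplicialMap C dec (fun q => cs_d C (ord0 : 'I_q.+2)) coface0_d coface0_s.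

Lemma codegeneracy0_coface0 q k (x : C q k) :
  cs_s C ord0 k (coface0 q k x) = x.
Proof.
by rewrite -[RHS](@cs_sd_id C q k x 0 0) // !inord_ord0.
Qed.

End Decalage.

Definition dec_map (C D : cosimplicial) (f : cosimplicialMap C D) :
    cosimplicialMap (dec C) (dec D) :=
  @CosimplicialMap (dec C) (dec D) (fun q => f q.+1)
    (fun q i => csm_d f (lift ord0 i)) (fun q i => csm_s f (lift ord0 i)).

(** * Cone and codegeneracy on the permuted summands *)

Lemma dsum_map_idE (S : finType) (A B : zmodType) (f : {additive A -> B})
    (x : {ffun S -> A}) (s : S) :
  dsum_map (fun=> f) id x s = f (x s).
Proof.
rewrite /dsum_map sum_ffunE (bigD1 s) //= ffunE eqxx big1 ?addr0 // => t.
by rewrite ffunE eq_sym => /negPf ->.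
Qed.

Lemma lift_perm_inj q (i j : 'I_q.+1) : injective (@lift_perm q i j).
Proof.
move=> s t /permP st; apply/permP => l.
by have := st (lift i l); rewrite !lift_perm_lift => /lift_inj.
Qed.

Section FSDecalage.
Variable C : cosimplicial.

(* On an operation [th : [p] -> [q]] of a summand [s], preceding by [FS_cone]
   and following by [FS_codeg0] gives [(0, th) : [p + 1] -> [q]] on the summand
   [1 x s]. *)
Definition FS_cone q k (x : FS C q.+1 k) : FS (dec C) q k :=
  [ffun s : 'S_q => x (lift_perm ord0 ord0 s)].

Lemma FS_cone_additive q k : zmod_morphism (@FS_cone q k).
Proof. by move=> x y; apply/ffunP => s; rewrite !ffunE. Qed.

HB.instance Definition _ q k :=
  GRing.isZmodMorphism.Build (FS C q.+1 k) (FS (dec C) q k) (@FS_cone q k)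
    (@FS_cone_additive q k).

(** The maps [s_0] do not form a cosimplicial map from [dec C] to [C]: [s_0 d_1] is the identity,
    where [d_0 s_0] would be required. Hence this is defined summand by summand and not as an
    instance of [FS_map]. *)
Definition FS_codeg0 q k (x : FS (dec C) q k) : FS C q k :=
  [ffun s : 'S_q => cs_s C ord0 k (x s)].

Lemma FS_codeg0_additive q k : zmod_morphism (@FS_codeg0 q k).
Proof. by move=> x y; apply/ffunP => s; rewrite !ffunE raddfB. Qed.

HB.instance Definition _ q k :=
  GRing.isZmodMorphism.Build (FS (dec C) q k) (FS C q k) (@FS_codeg0 q k)
    (@FS_codeg0_additive q k).

Lemma FS_codeg0_coface0 q k (x : FS C q k) :
  FS_codeg0 (FS_map (coface0 C) q k x) = x.
Proof.
by apply/ffunP => s; rewrite ffunE /= /FS_map_fun dsum_map_idE codegeneracy0_coface0.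
Qed.

Lemma FS_cone_v q k (x : FS C q.+1 (k + 1)) :
  ch_d (FS (dec C) q) k (FS_cone x) = FS_cone (ch_d (FS C q.+1) k x).
Proof. by apply/ffunP => s; rewrite ffunE /= /FS_bd !dsum_map_idE ffunE. Qed.

Lemma FS_codeg0_v q k (x : FS (dec C) q (k + 1)) :
  ch_d (FS C q) k (FS_codeg0 x) = FS_codeg0 (ch_d (FS (dec C) q) k x).
Proof.
by apply/ffunP => s; rewrite ffunE /= /FS_bd !dsum_map_idE ffunE cm_comm.
Qed.

Lemma FS_cone_summand q k (a : C q.+1 k) (t : 'S_q) :
  FS_cone (summand a (lift_perm ord0 ord0 t) : FS C q.+1 k) = summand (a : dec C q k) t.
Proof.
by apply/ffunP => u; rewrite !ffunE (inj_eq (@lift_perm_inj _ ord0 ord0)).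
Qed.

Lemma FS_cone_summand0 q k (a : C q.+1 k) (t : 'S_q.+1) : t ord0 != ord0 ->
  FS_cone (summand a t : FS C q.+1 k) = 0.
Proof.
move=> t0; apply/ffunP => u; rewrite !ffunE; case: eqP => // tu.
by case/negP: t0; rewrite -tu lift_perm_id.
Qed.

End FSDecalage.

(** * Permutations fixing the first input, and the extra degeneracy *)

Lemma lift_perm0_surj q (s : 'S_q.+1) : s ord0 = ord0 ->
  exists t : 'S_q, s = lift_perm ord0 ord0 t.
Proof.
move=> s0; exists (perm_s ord0 s); apply/permP => j.
case: (unliftP ord0 j) => [l|] ->; last by rewrite lift_perm_id.
rewrite lift_perm_lift permE s0.
have neq_s : ord0 != s (lift ord0 l).
  by rewrite -[X in X != _]s0 (inj_eq perm_inj) neq_lift.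
by have [l' E ->] := unlift_some neq_s.
Qed.

(** Since [1 x s] is [d_0(s)], this is the cosimplicial identity [d_(i+1) d_0 = d_0 d_i] for
    permutations. *)
Lemma perm_d_lift q (i : 'I_q.+2) (s : 'S_q) :
  perm_d (lift ord0 i) (lift_perm ord0 ord0 s) = lift_perm ord0 ord0 (perm_d i s).
Proof.
have e0 n (t : 'S_n) : lift_perm ord0 ord0 t = perm_d (inord 0) t.
  by rewrite /perm_d -val_eqE /= inordK.
have iq := ltn_ord i.
by rewrite -(inord_val i) lift0_inord // !e0 perm_dd //; lia.
Qed.

Lemma bar_perm_lift q (i : 'I_q.+2) (s : 'S_q) :
  bar_perm (lift_perm ord0 ord0 s) (lift ord0 i) = lift ord0 (bar_perm s i).
Proof.
have iq := ltn_ord i.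
apply: val_inj; rewrite /= -!bar_nat_ord.
rewrite (_ : lift_perm _ _ s = perm_d ord0 s) // bar_nat_d //= bar_nat0.
rewrite /bump /= add1n; case: eqP => [[->]|i0]; first by rewrite bar_nat0.
rewrite (_ : unbump 1 i.+1 = i); last by rewrite /unbump; lia.
by rewrite (_ : (0 < _)%N) //; apply: bar_nat_gt0; lia.
Qed.

(** A coface of positive index never inserts the first input, and the insertion can only raise the
    value there. So these cofaces preserve the summands killed by [FS_cone]. *)
Lemma perm_d_moves0 q (i : 'I_q.+2) (s : 'S_q.+1) :
  s ord0 != ord0 -> perm_d (lift ord0 i) s ord0 != ord0.
Proof.
move=> s0; apply/eqP => /(congr1 (fun o : 'I__ => o.+1)).
rewrite -bar_natS bar_nat_d //= /unbump /=.
have := bar_natS s ord0; rewrite /= => ->.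
by move: s0; rewrite -val_eqE /= /bump; lia.
Qed.

(** The coface [d_0] sends [(a, s)] to [(d_0 a, 1 x s)], which the cone projects to [(d_0 a, s)].
    Each [d_(i+1)] turns into [d_i] over [dec C], and this shift of the index reverses the sign. If
    [s] moves the first input, the terms other than that of [d_0] vanish on both sides. *)
Lemma FS_cone_h (C : cosimplicial) q k (x : FS C q.+1 k) :
  FS_cone (cs_h x) =
  FS_map (coface0 C) q.+1 k x *~ (-1) ^ k - cs_h (FS_cone x).
Proof.
elim/summand_ind: x => [|x y IHx IHy|a s]; first by rewrite !raddf0 mul0rz addr0.
  by rewrite !raddfD /= IHx IHy mulrzDl addrACA.
rewrite {1}/cs_h big_ord_recl raddfD raddfMz /= /FS_d dsum_map_summand.
have bar0 : bar_perm s ord0 = ord0 by rewrite /bar_perm lift_perm_id.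
have d0 : perm_d ord0 s = lift_perm ord0 ord0 s by [].
rewrite bar0 d0 FS_cone_summand /FS_map_fun dsum_map_summand add0r; congr (_ + _).
rewrite raddf_sum /cs_h -sumrN; apply: eq_bigr => i _.
rewrite raddfMz /= dsum_map_summand.
case: (eqVneq (s ord0) ord0) => [/lift_perm0_surj[t ->]|s0]; last first.
  by rewrite !FS_cone_summand0 ?perm_d_moves0 // raddf0 !mul0rz oppr0.
rewrite bar_perm_lift perm_d_lift !FS_cone_summand /FS_d dsum_map_summand /=.
by rewrite -mulrNz !sign_shift /bump /= add1n exprS mulN1r mulNr.
Qed.

(** * Naturality of the ingredients; [iota] against [m] *)

Lemma FS_map_cone (C D : cosimplicial) (f : cosimplicialMap C D) q k (x : FS C q.+1 k) :
  FS_cone (FS_map f q.+1 k x) = FS_map (dec_map f) q k (FS_cone x).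
Proof.
by apply/ffunP => s; rewrite ffunE /= /FS_map_fun !dsum_map_idE ffunE.
Qed.

Lemma FS_map_codeg0 (C D : cosimplicial) (f : cosimplicialMap C D) q k (x : FS (dec C) q k) :
  FS_map f q k (FS_codeg0 x) = FS_codeg0 (FS_map (dec_map f) q k x).
Proof.
by apply/ffunP => s; rewrite ffunE /= /FS_map_fun !dsum_map_idE ffunE csm_s.
Qed.

Lemma FS_map_iota (C D : cosimplicial) (f : cosimplicialMap C D) q k (x : C q k) :
  FS_map f q k (iota_FS C q k x) = iota_FS D q k (f q k x).
Proof. exact: dsum_map_summand. Qed.

Lemma FS_map_sgn (C D : cosimplicial) (f : cosimplicialMap C D) q k (x : FS C q k) :
  f q k (sgn_map C q k x) = sgn_map D q k (FS_map f q k x).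
Proof.
rewrite /= /sgn_fun raddf_sum; apply: eq_bigr => s _.
by rewrite raddfMz /FS_map_fun dsum_map_idE.
Qed.

Lemma sgn_iota (C : cosimplicial) q k (x : C q k) : sgn_map C q k (iota_FS C q k x) = x.
Proof. by rewrite /= /iota_fun sgn_fun_summand odd_perm1. Qed.

(** The group ['S_0] is trivial. This starts the recursion: in degree 0 there is nothing to
    correct. *)
Lemma iota_sgn0 (C : cosimplicial) k (x : FS C 0 k) : iota_FS C 0 k (sgn_map C 0 k x) = x.
Proof.
have S0 (s : 'S_0) : s = 1%g by apply/permP => -[].
apply/ffunP => t; rewrite ffunE (S0 t) eqxx /= /sgn_fun (bigD1 1%g) //=.
by rewrite odd_perm1 big1 ?addr0 // => s; rewrite (S0 s) eqxx.
Qed.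

(** * The recursive homotopy *)

(** [C] is quantified inside the recursion because the recursive call is at [dec C]. The factor
    [(-1) ^ k] cancels the one in front of [d_0] in [FS_cone_h]. *)
Fixpoint FS_htpy (q : nat) : forall (C : cosimplicial) k, FS C q.+1 k -> FS C q k :=
  match q with
  | 0 => fun C k x => 0
  | p.+1 => fun C k x => let y := FS_cone x in
    FS_codeg0 (iota_FS (dec C) p.+1 k (sgn_map (dec C) p.+1 k y) - y
               - cs_h (@FS_htpy p (dec C) k y)) *~ (-1) ^ k
  end.
Arguments FS_htpy {q C k} x.

Lemma FS_htpy_additive q (C : cosimplicial) k : zmod_morphism (@FS_htpy q C k).
Proof.
elim: q C k => [|q IHq] C k x y /=; first by rewrite subr0.
rewrite -mulrzBl -raddfB; congr (FS_codeg0 _ *~ _).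
rewrite (raddfB (@FS_cone C q.+1 k)) IHq !raddfB /=.
by rewrite !opprK (addrACA (iota_fun _)) [LHS]addrACA.
Qed.

HB.instance Definition _ q (C : cosimplicial) k :=
  GRing.isZmodMorphism.Build (FS C q.+1 k) (FS C q k) (@FS_htpy q C k)
    (@FS_htpy_additive q C k).

Lemma FS_map_htpy q (C D : cosimplicial) (f : cosimplicialMap C D) k (x : FS C q.+1 k) :
  FS_map f q k (FS_htpy x) = FS_htpy (FS_map f q.+1 k x).
Proof.
elim: q C D f k x => [|q IHq] C D f k x; first exact: raddf0.
rewrite [FS_htpy _]/= raddfMz FS_map_codeg0 [RHS]/= FS_map_cone.
congr (FS_codeg0 _ *~ _); rewrite !raddfB FS_map_iota FS_map_sgn.
by rewrite -csm_h IHq.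
Qed.

(** The sign comes from the factor [(-1) ^ k], which flips with the chain degree. Everything else
    commutes with the vertical differential; in [d H] two anticommutations cancel. *)
Lemma FS_htpy_v q (C : cosimplicial) k (x : FS C q.+1 (k + 1)) :
  ch_d (FS C q) k (FS_htpy x) = - FS_htpy (ch_d (FS C q.+1) k x).
Proof.
elim: q C k x => [|q IHq] C k x; first by rewrite raddf0 oppr0.
rewrite [FS_htpy _]/= raddfMz FS_codeg0_v [FS_htpy (ch_d _ _ _)]/= -FS_cone_v.
rewrite -mulrNz exprzDr // expr1z mulrN1; congr (FS_codeg0 _ *~ _).
have ch_dB n (y z : FS (dec C) n (k + 1)) :
  ch_d (FS (dec C) n) k (y - z) = ch_d (FS (dec C) n) k y - ch_d (FS (dec C) n) k z.
  exact: raddfB.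
rewrite !ch_dB [X in X - _ - _]iota_bd.
congr (iota_FS _ _ _ _ - _ - _); first exact: sgn_v.
by have /eqP := cs_hv (FS_htpy (FS_cone x)); rewrite addr_eq0 IHq raddfN opprK => /eqP.
Qed.

Arguments FS_htpy : simpl never.

(** * The homotopy identity for the horizontal differential *)

(** What the term [H d] must equal for [H] to be a homotopy from [iota m] to the identity. *)
Definition FS_gap q (C : cosimplicial) k (x : FS C q.+1 k) : FS C q.+1 k :=
  iota_FS C q.+1 k (sgn_map C q.+1 k x) - x - cs_h (FS_htpy x).

Lemma FS_gap_additive q (C : cosimplicial) k : zmod_morphism (@FS_gap q C k).
Proof.
move=> x y; rewrite /FS_gap !raddfB /=.
by rewrite !opprK (addrACA (iota_fun _)) [LHS]addrACA.
Qed.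

HB.instance Definition _ q (C : cosimplicial) k :=
  GRing.isZmodMorphism.Build (FS C q.+1 k) (FS C q.+1 k) (@FS_gap q C k)
    (@FS_gap_additive q C k).

Lemma FS_map_gap q (C D : cosimplicial) (f : cosimplicialMap C D) k (x : FS C q.+1 k) :
  FS_map f q.+1 k (FS_gap x) = FS_gap (FS_map f q.+1 k x).
Proof.
by rewrite /FS_gap !raddfB FS_map_iota FS_map_sgn -csm_h FS_map_htpy.
Qed.

Lemma iota_sgn_h (C : cosimplicial) q k (x : FS C q k) :
  iota_FS C q.+1 k (sgn_map C q.+1 k (cs_h x)) =
  cs_h (iota_FS C q k (sgn_map C q k x)).
Proof. by rewrite csm_h; congr (iota_FS _ _ _ _); rewrite [RHS]sgn_h. Qed.

(* Since [FS_codeg0] retracts the coface [d_0], naturality of [FS_gap] turns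
   [FS_cone_h] into this identity as soon as [FS_gap] kills coboundaries. *)
Lemma FS_htpy_gap q k :
  (forall (C : cosimplicial) (x : FS C q k), FS_gap (cs_h x) = 0) ->
  forall (C : cosimplicial) (x : FS C q.+1 k), FS_htpy (cs_h x) = FS_gap x.
Proof.
move=> gap0 C x.
have -> (y : FS C q.+2 k) :
  FS_htpy y = FS_codeg0 (FS_gap (FS_cone y)) *~ (-1) ^ k by [].
have gapB (y z : FS (dec C) q.+1 k) : FS_gap (y - z) = FS_gap y - FS_gap z.
  exact: raddfB.
have gapM (y : FS (dec C) q.+1 k) n : FS_gap (y *~ n) = FS_gap y *~ n.
  exact: raddfMz.
have codegM (y : FS (dec C) q.+1 k) n : FS_codeg0 (y *~ n) = FS_codeg0 y *~ n.
  exact: raddfMz.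
rewrite FS_cone_h gapB gap0 subr0 gapM codegM -FS_map_gap FS_codeg0_coface0.
by rewrite -mulrzA -exprzMl ?unitrN1 // mulrNN mulr1 exp1rz.
Qed.

(** The gap of [d x] is [d (iota m x - x - H d x)]. In degree 0 the bracket vanishes; in higher
    degrees it is [d H x] by induction, and [d d = 0]. *)
Lemma FS_htpy_h q (C : cosimplicial) k (x : FS C q.+1 k) :
  FS_htpy (cs_h x) = FS_gap x.
Proof.
elim: q C x => [|q IHq]; apply: FS_htpy_gap => C x.
  by rewrite /FS_gap iota_sgn_h iota_sgn0 subrr !raddf0 addr0.
by rewrite /FS_gap IHq iota_sgn_h !raddfB /= cs_hh !oppr0 addr0 -opprD subrr.
Qed.

(** * Passage to the totalization *)

Section TotHomotopy.
Variable C : cosimplicial.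

Lemma tot_index_s (n : nat) (k m : int) : n%:Z - k == m -> n.+1%:Z - k == m + 1.
Proof. lia. Qed.

(** No sign is inserted: [H] anticommutes with the vertical differential, so the vertical terms of
    the homotopy identity cancel. *)
Definition tot_htpy m (a : Tot (FS C) (m + 1)) : Tot (FS C) m :=
  fun n k e => FS_htpy (a n.+1 k (tot_index_s e)).

Lemma tot_htpy_additive m : zmod_morphism (@tot_htpy m).
Proof. by move=> a b; apply: tot_ext => n k e; apply: (raddfB (@FS_htpy n C k)). Qed.

HB.instance Definition _ m :=
  GRing.isZmodMorphism.Build (Tot (FS C) (m + 1)) (Tot (FS C) m) (@tot_htpy m)
    (@tot_htpy_additive m).

Lemma tot_htpyP :
  cochain_homotopy
    (cochain_comp (Tot_map (iota_FS C)) (totalization_map (sgn_map C)))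
    (cochain_id (Tot (FS C))) tot_htpy.
Proof.
move=> m x; apply: tot_ext => n k e.
transitivity (iota_FS C n k (sgn_map C n k (x n k e)) - x n k e); first by [].
transitivity (@tot_d _ _ (tot_htpy x) n k e +
  FS_htpy (@tot_d (cs_bicomplex (FS C)) _ x n.+1 k (tot_index_s e))); last by [].
rewrite /= raddfB /=.
have -> : tot_index_h (tot_index_s e) = e by apply: bool_irrelevance.
case: n e => [|n] e /=; rewrite FS_htpy_v /tot_htpy.
  (* In cosimplicial degree 0, [iota m] is the identity and [H] is 0 by definition. *)
  by rewrite iota_sgn0 subrr subr0 opprK addr0.
rewrite FS_htpy_h /FS_gap opprK (bool_irrelevance (tot_index_s (tot_index_v e))
  (tot_index_v (tot_index_s e))) (bool_irrelevance (tot_index_s (tot_index_h e)) e).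
by rewrite -[X in _ = _ + X]addrA -opprD [RHS]addrC subrK.
Qed.

End TotHomotopy.

Theorem theorem4p4 :
  (forall C : cosimplicial, fg_torsion_free_components C ->
     mutually_inverse_homotopy_equivalences
       (Tot_map (iota_FS C)) (totalization_map (sgn_map C))) /\
  (forall (C D : cosimplicial) (f : cosimplicialMap C D),
     fg_torsion_free_components C -> fg_torsion_free_components D ->
     (forall (m : int) (x : Tot C m),
        Tot_map (FS_map f) m (Tot_map (iota_FS C) m x) =
        Tot_map (iota_FS D) m (Tot_map f m x)) /\
     (forall (m : int) (x : Tot (FS C) m),
        Tot_map f m (totalization_map (sgn_map C) m x) =
        totalization_map (sgn_map D) m (Tot_map (FS_map f) m x))) /\
  (forall C : cosimplicial, fg_torsion_free_components C ->
     forall (m : int) (x : Tot C m),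
       totalization_map (sgn_map C) m (Tot_map (iota_FS C) m x) = x) /\
  (exists h : forall C : cosimplicial, fg_torsion_free_components C ->
       forall m : int, {additive Tot (FS C) (m + 1)%R -> Tot (FS C) m},
     (forall (C : cosimplicial) (HC : fg_torsion_free_components C),
        cochain_homotopy
          (cochain_comp (Tot_map (iota_FS C)) (totalization_map (sgn_map C)))
          (cochain_id (Tot (FS C))) (h C HC)) /\
     (forall (C D : cosimplicial) (f : cosimplicialMap C D)
        (HC : fg_torsion_free_components C) (HD : fg_torsion_free_components D)
        (m : int) (x : Tot (FS C) (m + 1)%R),
        Tot_map (FS_map f) m (h C HC m x) =
        h D HD m (Tot_map (FS_map f) (m + 1) x))).
Proof.
have sgn_iotaT (C : cosimplicial) m (x : Tot C m) :
    totalization_map (sgn_map C) m (Tot_map (iota_FS C) m x) = x.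
  by apply: tot_ext => n k e; apply: sgn_iota.
split=> [C _|]; first split.
(* This composite is the identity itself, so the zero homotopy serves. *)
- exists (fun m => \0) => m x.
  by rewrite /= !raddf0 sgn_iotaT subrr addr0.
- by exists (fun m => @tot_htpy C m); apply: tot_htpyP.
split=> [C D f _ _|]; first split=> m x; last split=> [C _|]; last first.
- exists (fun C _ m => @tot_htpy C m).
  split=> [C _|C D f _ _ m x]; first exact: tot_htpyP.
  by apply: tot_ext => n k e; apply: FS_map_htpy.
- exact: sgn_iotaT.
- by apply: tot_ext => n k e; apply: FS_map_sgn.
- by apply: tot_ext => n k e; apply: FS_map_iota.
Qed.
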